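(* Let $k$ be a positive integer. For all integers $\ell_o,m,n\geq 0$, \[ O_{k,k}(\ell_o,m,n)=P_{k}(\ell_o,m+(k-1)\ell_o,n). \]
   Context: An overpartition is a partition in which the first occurrence of each part size may be overlined. A $(k,k)$-overpartition is an overpartition in which only parts divisible by $k$ may be overlined. A $k$-partition is a partition in which, for each part size occurring at least $k$ times, the $k$-th occurrence of that part may (optionally) be overlined. $O_{k,k}(\ell_o,m,n)$ denotes the number of $(k,k)$-overpartitions of $n$ with exactly $\ell_o$ overlined parts and exactly $m$ parts, and $P_k(\ell_o,m,n)$ denotes the number of $k$-partitions of $n$ with exactly $\ell_o$ overlined parts and exactly $m$ parts. *)

(* Defs.v *)
From mathcomp Require Import all_boot.

Set Implicit Arguments.
Unset Strict Implicit.
Unset Printing Implicit Defensive.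

(* A partition some of whose parts may be overlined is the sequence of its
   parts in nonincreasing order; (a, true) is an overlined part of size a and
   (a, false) a non-overlined one. *)
Definition part := (nat * bool)%type.

Definition part_size (p : part) : nat := p.1.
Definition overlined (p : part) : bool := p.2.

Definition sizes (s : seq part) : seq nat := [seq part_size p | p <- s].

Definition is_partition (r : seq nat) : bool :=
  sorted geq r && all (fun a => 0 < a) r.

Definition weight (s : seq part) : nat := sumn (sizes s).
Definition num_overlined (s : seq part) : nat := count overlined s.

(* The entry of r at index i is the (occurrence r i)-th occurrence of its size,
   counting occurrences from 1. *)
Definition occurrence (r : seq nat) (i : nat) : nat :=
  count_mem (nth 0 r i) (take i.+1 r).

Definition overlined_at (s : seq part) (i : nat) : bool :=
  overlined (nth (0, false) s i).

Definition overpartition (s : seq part) : bool :=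
  is_partition (sizes s) &&
  [forall i : 'I_(size s), overlined_at s i ==> (occurrence (sizes s) i == 1)].

Definition kk_overpartition (k : nat) (s : seq part) : bool :=
  overpartition s && all (fun p => overlined p ==> (k %| part_size p)) s.

Definition k_partition (k : nat) (s : seq part) : bool :=
  is_partition (sizes s) &&
  [forall i : 'I_(size s), overlined_at s i ==> (occurrence (sizes s) i == k)].

(* The parts of a partition of n are at most n, so the objects with m parts are
   counted among the m-tuples over the finite type 'I_n.+1 * bool; see
   parts_ofP for the fact that no object is missed or counted twice. *)
Definition parts_of (m n : nat) (t : m.-tuple ('I_n.+1 * bool)) : seq part :=
  [seq (val p.1, p.2) | p <- t].

Definition num_of (Q : pred (seq part)) (l m n : nat) : nat :=
  #|[set t : m.-tuple ('I_n.+1 * bool) |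
      [&& Q (parts_of t), weight (parts_of t) == n
        & num_overlined (parts_of t) == l]]|.

Definition O_kk (k l m n : nat) : nat := num_of (kk_overpartition k) l m n.
Definition P_k (k l m n : nat) : nat := num_of (k_partition k) l m n.

Lemma parts_of_inj m n : injective (@parts_of m n).
Proof.
move=> t u /inj_map tu; apply/val_inj/tu.
by move=> [a b] [c d] [/val_inj -> ->].
Qed.

Lemma parts_ofP m n (s : seq part) :
  size s = m -> weight s = n ->
  exists! t : m.-tuple ('I_n.+1 * bool), parts_of t = s.
Proof.
move=> sm sn.
have le_n p : p \in s -> p.1 < n.+1.
  rewrite -sn ltnS /weight /sizes; elim: s {sm sn} => //= q s IH.
  rewrite inE => /predU1P[-> | /IH le_p]; first exact: leq_addr.
  exact: leq_trans le_p (leq_addl _ _).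
have sz : size [seq (inord p.1 : 'I_n.+1, p.2) | p <- s] == m.
  by rewrite size_map sm.
have ts : parts_of (Tuple sz) = s.
  rewrite /parts_of /= -map_comp -[RHS]map_id; apply/eq_in_map => -[a b] ps /=.
  by rewrite inordK //; exact: le_n ps.
by exists (Tuple sz); split=> // u us; apply: parts_of_inj; rewrite ts us.
Qed.

(* Main.v *)
Require Import Defs.
From mathcomp Require Import all_boot.
From mathcomp Require Import zify.

(** Overpartitions are the [j = 1] case of [j]-partitions.  Removing, for each
    overlined size [a], the first [j] copies of [a] identifies a [j]-partition
    with a pair [(S, u)]: the set [S] of its overlined sizes and an arbitrary
    partition [u].  The bijection keeps [u] and divides the elements of [S] by
    [k]: each overlined [k * a] is traded for [k] copies of [a], the [k]-th one
    overlined. *)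

Set Implicit Arguments.
Unset Strict Implicit.
Unset Printing Implicit Defensive.

(** * Comparing counts through injections *)

(** The counts are over tuples, while bijections are easier to describe on sequences. Since [f s]
    has known size and weight, [parts_ofP] lifts [f] to a map of tuples. *)
Lemma leq_num_of (Q Q' : pred (seq part)) (f : seq part -> seq part)
    (l m m' n : nat) :
  let obj s := [/\ Q s, size s = m, weight s = n & num_overlined s = l] in
  (forall s, obj s ->
    [/\ Q' (f s), size (f s) = m', weight (f s) = n
      & num_overlined (f s) = l]) ->
  (forall s t, obj s -> obj t -> f s = f t -> s = t) ->
  num_of Q l m n <= num_of Q' l m' n.
Proof.
move=> obj fP f_inj.
pose F (t : m.-tuple ('I_n.+1 * bool)) : m'.-tuple ('I_n.+1 * bool) :=
  (* The default tuple is a dummy: on counted tuples [parts_ofP] makes the [pick] succeed. *)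
  odflt [tuple of nseq m' (ord0, false)]
    [pick u | parts_of u == f (parts_of t)].
have objP t : t \in [set t : m.-tuple ('I_n.+1 * bool) |
    [&& Q (parts_of t), weight (parts_of t) == n
      & num_overlined (parts_of t) == l]] -> obj (parts_of t).
  rewrite inE => /and3P[Qt /eqP wt /eqP lt]; split=> //.
  by rewrite size_map size_tuple.
have FE t : obj (parts_of t) -> parts_of (F t) = f (parts_of t).
  case/fP=> _ sz wt _; have [u [us _]] := parts_ofP sz wt.
  rewrite /F; case: pickP => [v /eqP // | /(_ u)].
  by rewrite us eqxx.
rewrite /num_of -(card_in_imset (f := F)); last first.
  move=> t u /objP ot /objP ou eF; apply: (@parts_of_inj m n).
  by apply: f_inj => //; rewrite -!FE // eF.
apply/subset_leq_card/subsetP => _ /imsetP[t /objP ot ->].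
by rewrite inE FE //; have [-> _ -> ->] := fP _ ot; rewrite !eqxx.
Qed.

(** * Nonincreasing order, overlined sizes and occurrence numbers *)

Lemma geq_trans : transitive geq.
Proof. by move=> a b c ba ac; apply: leq_trans ba. Qed.

Lemma geq_anti : antisymmetric geq.
Proof. by move=> a b; rewrite andbC => /anti_leq. Qed.

Lemma geq_total : total geq.
Proof. by move=> a b; apply: leq_total. Qed.

Definition overlined_sizes (s : seq part) : seq nat :=
  [seq part_size p | p <- s & overlined p].

Lemma size_overlined_sizes s : size (overlined_sizes s) = num_overlined s.
Proof. by rewrite size_map size_filter. Qed.

(** Among entries of one size the occurrence number strictly increases with the index, as the later
    prefix also contains the later entry. *)
Lemma occurrence_inj (r : seq nat) (i i' : nat) :
  i < size r -> i' < size r -> nth 0 r i = nth 0 r i' ->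
  occurrence r i = occurrence r i' -> i = i'.
Proof.
wlog lt_ii' : i i' / i < i'.
  move=> W ir ir' e o; case: (ltngtP i i') => // lt; first exact: W.
  by apply/esym/W.
move=> ir ir' e; rewrite /occurrence e [in RHS](take_nth 0) //.
rewrite -cats1 count_cat /= eqxx => o.
have := leq_count_subseq (pred1 (nth 0 r i')) (take_subseq (take i' r) i.+1).
by rewrite take_takel // o addn0 addn1 ltnn.
Qed.

(** Appending [x] keeps all earlier occurrence numbers, and the new index has the new multiplicity
    of [x] as its number. So the count passes from 0 to 1 exactly when the multiplicity of [a]
    reaches [j]. *)
Lemma count_occurrence (r : seq nat) (a j : nat) : 0 < j ->
  count (fun i => (nth 0 r i == a) && (occurrence r i == j)) (iota 0 (size r))
  = (j <= count_mem a r).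
Proof.
move=> j0; elim/last_ind: r => [|r x IH] /=; first by rewrite leqNgt j0.
rewrite size_rcons -addn1 iotaD count_cat /= add0n addn0.
rewrite (_ : count _ (iota 0 (size r)) = (j <= count_mem a r)); last first.
  rewrite -IH; apply: eq_in_count => i; rewrite mem_iota add0n => /andP[_ ir].
  by rewrite /occurrence nth_rcons ir -cats1 takel_cat.
rewrite /occurrence nth_rcons ltnn eqxx take_oversize ?size_rcons //.
rewrite -cats1 !count_cat /= eq_sym.
by case: (eqVneq a x) => [->|_]; rewrite ?eqxx /=; lia.
Qed.

(** * Reconstruction from sizes and overlined sizes *)

(** Elements of [S] with fewer than [j] copies in [r] leave no trace. *)
Definition overline (j : nat) (S r : seq nat) : seq part :=
  [seq (nth 0 r i, (nth 0 r i \in S) && (occurrence r i == j))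
     | i <- iota 0 (size r)].

Lemma size_overline j S r : size (overline j S r) = size r.
Proof. by rewrite size_map size_iota. Qed.

Lemma sizes_overline j S r : sizes (overline j S r) = r.
Proof. by rewrite /sizes -map_comp -[RHS](mkseq_nth 0). Qed.

Lemma nth_overline j S r i : i < size r ->
  nth (0, false) (overline j S r) i
  = (nth 0 r i, (nth 0 r i \in S) && (occurrence r i == j)).
Proof. by move=> ir; rewrite (nth_map 0) ?size_iota // nth_iota. Qed.

Lemma count_overlined_overline j S r a : 0 < j ->
  count_mem a (overlined_sizes (overline j S r))
  = (a \in S) && (j <= count_mem a r).
Proof.
move=> j0; rewrite /overlined_sizes count_map count_filter count_map.
case: (boolP (a \in S)) => aS /=; last first.
  apply/eqP; rewrite -leqn0 leqNgt -has_count; apply/hasPn => i _ /=.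
  by apply/negP=> /and3P[/eqP e iS _]; move: aS; rewrite -e iS.
rewrite -count_occurrence //; apply: eq_count => i /=.
by rewrite /part_size /=; case: eqP => //= ->; rewrite aS.
Qed.

Lemma sorted_overlined_sizes s :
  sorted geq (sizes s) -> sorted geq (overlined_sizes s).
Proof.
apply: (subseq_sorted geq_trans).
exact/map_subseq/filter_subseq.
Qed.

Lemma k_partition_overline j S r :
  is_partition r -> k_partition j (overline j S r).
Proof.
move=> pr; rewrite /k_partition sizes_overline pr; apply/forallP => -[i] /=.
rewrite size_overline /overlined_at => ir.
by rewrite nth_overline //=; apply/implyP => /andP[].
Qed.

(** An overline can only sit on a [j]-th occurrence, and a size has at most one of these, so knowing
    which sizes are overlined fixes every overline. *)
Lemma k_partitionE j s : k_partition j s ->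
  s = overline j (overlined_sizes s) (sizes s).
Proof.
case/andP=> _ /forallP H.
have occ i : i < size s -> overlined_at s i -> occurrence (sizes s) i = j.
  by move=> si oi; have /implyP/(_ oi)/eqP := H (Ordinal si).
have szs : size (sizes s) = size s by rewrite size_map.
apply: (@eq_from_nth _ (0, false)) => [|i si]; first by rewrite size_overline szs.
rewrite nth_overline ?szs // [nth 0 _ _](nth_map (0, false)) //.
rewrite [LHS]surjective_pairing; congr pair; rewrite -/(overlined_at s i).
apply/idP/andP => [oi | [/mapP[p]]].
  split; last by rewrite occ.
  apply/map_f; rewrite mem_filter mem_nth // andbT; exact: oi.
(* The size at [i] is overlined at some index [i']; both indices are [j]-th occurrences of it, hence
   equal. *)
rewrite mem_filter => /andP[op /(nthP (0, false))[i' si' def_p]] e /eqP oj.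
have oi' : overlined_at s i' by rewrite /overlined_at def_p.
suff -> : i = i' by [].
apply: (@occurrence_inj (sizes s)); rewrite ?szs //; last by rewrite oj occ.
by rewrite !(nth_map (0, false)) // def_p.
Qed.

(** * Adding and removing [j] copies of each overlined size *)

(** This is a multiset union; sorting picks its nonincreasing listing, so equalities reduce to
    multiplicities. *)
Definition add_copies (j : nat) (S u : seq nat) : seq nat :=
  sort geq (u ++ flatten [seq nseq j a | a <- S]).

Lemma count_copies j S (P : pred nat) :
  count P (flatten [seq nseq j a | a <- S]) = j * count P S.
Proof.
elim: S => [|a S IH] /=; first by rewrite muln0.
by rewrite count_cat IH count_nseq mulnDr mulnC.
Qed.

Lemma count_add_copies j S u (P : pred nat) :
  count P (add_copies j S u) = count P u + j * count P S.
Proof. by rewrite (permP (permEl (perm_sort _ _))) count_cat count_copies. Qed.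

Lemma size_add_copies j S u : size (add_copies j S u) = size u + j * size S.
Proof. by rewrite -!count_predT count_add_copies. Qed.

Lemma sumn_add_copies j S u : sumn (add_copies j S u) = sumn u + j * sumn S.
Proof.
rewrite (perm_sumn (permEl (perm_sort _ _))) sumn_cat; congr (_ + _).
elim: S => [|a S IH] /=; first by rewrite muln0.
by rewrite sumn_cat IH sumn_nseq mulnDr mulnC.
Qed.

Lemma is_partition_add_copies j S u :
  all (ltn 0) S -> all (ltn 0) u -> is_partition (add_copies j S u).
Proof.
move=> S0 u0; rewrite /is_partition (sort_sorted geq_total) /=.
rewrite all_count count_add_copies size_add_copies.
by move: S0 u0; rewrite !all_count => /eqP -> /eqP ->.
Qed.

Lemma add_copies_inj j S u v : sorted geq u -> sorted geq v ->
  add_copies j S u = add_copies j S v -> u = v.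
Proof.
move=> su sv e; apply: (sorted_eq geq_trans geq_anti su sv).
apply/permP => P; have := count_add_copies j S u P.
by rewrite e count_add_copies => /addIn.
Qed.

(** The truncated subtraction is right because [rem] does nothing to a sequence lacking the
    element. *)
Lemma count_foldr_rem (r b : seq nat) a :
  count_mem a (foldr (fun x t => rem x t) r b) = count_mem a r - count_mem a b.
Proof.
elim: b => [|x b IH] /=; first by rewrite subn0.
rewrite count_rem IH /=; case: (eqVneq x a) => [->|_]; last by rewrite andbF; lia.
rewrite andbT -has_pred1 has_count IH add1n subnS.
by case: (count_mem a r - count_mem a b) => // c; rewrite subn1.
Qed.

Definition remove_copies (j : nat) (S r : seq nat) : seq nat :=
  foldr (fun x t => rem x t) r (flatten [seq nseq j a | a <- S]).

Lemma remove_copies_subseq j S r : subseq (remove_copies j S r) r.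
Proof.
rewrite /remove_copies; elim: (flatten _) => //= x b IH.
exact: subseq_trans (rem_subseq _ _) IH.
Qed.

(** The bound on multiplicities keeps the subtraction in [count_foldr_rem] from truncating. *)
Lemma remove_copiesK j S r :
  sorted geq r -> (forall a, j * count_mem a S <= count_mem a r) ->
  add_copies j S (remove_copies j S r) = r.
Proof.
move=> sr H; apply: (sorted_eq geq_trans geq_anti) => //.
  exact: (sort_sorted geq_total).
apply/allP => a _; apply/eqP.
by rewrite /= count_add_copies count_foldr_rem count_copies subnK.
Qed.

Definition strict_partition (S : seq nat) : bool :=
  is_partition S && uniq S.

(** Each element of [S] has gained [j] copies, so its [j]-th occurrence exists and is overlined,
    once; as [S] has no repetitions, the multiplicities agree. *)
Lemma overlined_add_copies j S u : 0 < j -> strict_partition S ->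
  overlined_sizes (overline j S (add_copies j S u)) = S.
Proof.
move=> j0 /andP[/andP[sS _] uS].
apply: (sorted_eq geq_trans geq_anti) => //.
  apply: sorted_overlined_sizes; rewrite sizes_overline.
  exact: (sort_sorted geq_total).
apply/allP => a _; apply/eqP; rewrite /= count_overlined_overline //.
rewrite count_add_copies !(count_uniq_mem a uS).
by case: (a \in S); rewrite ?muln1 ?leq_addl.
Qed.

(** The component [u] of the pair [(S, u)] attached to a [j]-partition. *)
Definition rest (j : nat) (s : seq part) : seq nat :=
  remove_copies j (overlined_sizes s) (sizes s).

Lemma rest_partition j s : k_partition j s -> is_partition (rest j s).
Proof.
case/andP=> /andP[sr r0] _.
have sub := remove_copies_subseq j (overlined_sizes s) (sizes s).
rewrite /is_partition (subseq_sorted geq_trans sub sr) /=.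
by apply/allP=> a /(mem_subseq sub); apply: (allP r0).
Qed.

Lemma overlined_sizes_strict j s : 0 < j -> k_partition j s ->
  strict_partition (overlined_sizes s).
Proof.
move=> j0 ps; have /andP[/andP[sr r0] _] := ps.
rewrite /strict_partition /is_partition sorted_overlined_sizes //=.
apply/andP; split.
  apply/allP=> a aS; apply: (allP r0); apply: mem_subseq aS.
  exact/map_subseq/filter_subseq.
(* By [count_overlined_overline] each multiplicity is the value of a boolean, hence at most 1. *)
apply/count_mem_uniq => a.
have := count_overlined_overline (overlined_sizes s) (sizes s) a j0.
rewrite -k_partitionE // -has_pred1 has_count => ->.
by case: (_ && _).
Qed.

Lemma add_copies_rest j s : 0 < j -> k_partition j s ->
  add_copies j (overlined_sizes s) (rest j s) = sizes s.
Proof.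
move=> j0 ps; have /andP[/andP[sr _] _] := ps.
apply: remove_copiesK => // a.
by rewrite [in X in X <= _](k_partitionE ps) count_overlined_overline //; lia.
Qed.

Lemma k_partition_inj j s t : 0 < j -> k_partition j s -> k_partition j t ->
  overlined_sizes s = overlined_sizes t -> rest j s = rest j t -> s = t.
Proof.
move=> j0 ps pt eS eu; rewrite (k_partitionE ps) (k_partitionE pt).
by rewrite -(add_copies_rest j0 ps) -(add_copies_rest j0 pt) eS eu.
Qed.

(** * The trade of overlined sizes *)

(** Keeping [rest], [j] copies of each overlined [a] become [j'] copies of [h a], of the same total
    weight. The equation on [m] and [m'] says, without subtraction, that [rest] keeps its number of
    parts. Stating this symmetrically lets it serve for both inequalities. *)
Lemma leq_num_of_trade (j j' : nat) (D D' : pred nat) (h : nat -> nat)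
    (l m m' n : nat) :
  0 < j -> 0 < j' -> m + j' * l = m' + j * l ->
  (forall a, D a -> D' (h a) /\ j' * h a = j * a) ->
  num_of (fun s => k_partition j s && all D (overlined_sizes s)) l m n <=
  num_of (fun s => k_partition j' s && all D' (overlined_sizes s)) l m' n.
Proof.
move=> j0 j0' em hP.
have h_inj : {in D &, injective h}.
  move=> a b /hP[_ ea] /hP[_ eb] e; move: eb; rewrite -e ea => /eqP.
  by rewrite eqn_pmul2l // => /eqP.
have hS S : all D S -> strict_partition S -> strict_partition (map h S).
  move=> /allP DS /andP[/andP[sS /allP S0] uS]; apply/andP; split; last first.
    by rewrite map_inj_in_uniq // => a b /DS Da /DS Db; apply: h_inj.
  apply/andP; split; last first.
    rewrite all_map; apply/allP => a aS /=; have [_ e] := hP _ (DS _ aS).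
    by have := S0 _ aS; nia.
  (* On [D], [h] preserves order: multiplying by [j'] turns the comparison of images into that of
     [j * a] and [j * b]. *)
  rewrite sorted_map; apply: (sub_in_sorted (P := mem S)) sS; last exact/allP.
  move=> a b /DS/hP[_ ea] /DS/hP[_ eb] /= ab.
  by rewrite -(leq_pmul2l j0') ea eb leq_mul2l ab orbT.
pose f s := let S := map h (overlined_sizes s) in
  overline j' S (add_copies j' S (rest j s)).
have fS s : k_partition j s -> all D (overlined_sizes s) ->
    overlined_sizes (f s) = map h (overlined_sizes s).
  by move=> ps Ds; apply/overlined_add_copies/hS/(overlined_sizes_strict j0).
apply: (leq_num_of (f := f)) => [s [/andP[ps Ds] sz wt lt]|s t].
  have eS := fS _ ps Ds; have er := add_copies_rest j0 ps.
  have szS := size_overlined_sizes s.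
  have /andP[/andP[_ S0] _] := hS _ Ds (overlined_sizes_strict j0 ps).
  have /andP[_ u0] := rest_partition ps.
  have eW : j' * sumn (map h (overlined_sizes s)) = j * sumn (overlined_sizes s).
    elim: (overlined_sizes s) Ds => [|a S IH] /=; first by rewrite !muln0.
    by case/andP=> /hP[_ ea] /IH; rewrite !mulnDr ea => ->.
  split.
  - rewrite k_partition_overline ?is_partition_add_copies //= eS all_map.
    by apply: sub_all Ds => a /hP[].
  - have := congr1 size er; rewrite size_overline !size_add_copies (size_map h) szS lt.
    by rewrite (size_map part_size) sz; lia.
  - rewrite -wt /weight -er sizes_overline !sumn_add_copies.
    by rewrite eW.
  - by rewrite -size_overlined_sizes eS size_map szS.
move=> [/andP[ps Ds] _ _ _] [/andP[pt Dt] _ _ _] e.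
have eS : overlined_sizes s = overlined_sizes t.
  have := congr1 overlined_sizes e; rewrite !fS //.
  (* Injectivity of [h] holds only on [D], so the two lists are compared entry by entry. *)
  elim: (overlined_sizes s) (overlined_sizes t) Ds Dt => [|a S IH] [|b T] //=.
  by move=> /andP[Da DS] /andP[Db DT] [/h_inj -> // /IH ->].
apply: (k_partition_inj j0) => //.
have := congr1 sizes e; rewrite !sizes_overline eS.
by apply: add_copies_inj; [have /andP[] := rest_partition ps
                          |have /andP[] := rest_partition pt].
Qed.

Lemma eq_num_of (Q Q' : pred (seq part)) l m n :
  Q =1 Q' -> num_of Q l m n = num_of Q' l m n.
Proof. by move=> e; apply: eq_card => t; rewrite !inE e. Qed.

Theorem theorem1p1 (k : nat) (hk : 0 < k) (l m n : nat) :
  O_kk k l m n = P_k k l (m + (k - 1) * l) n.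
Proof.
pose Q j D s := k_partition j s && all D (overlined_sizes s).
(* Overpartitions are [k_partition 1] by definition, and the condition on overlined parts passes to
   the list of overlined sizes. *)
rewrite /O_kk /P_k (@eq_num_of _ (Q 1 (dvdn k))); last first.
  by move=> s; rewrite /Q all_map all_filter.
rewrite [RHS](@eq_num_of _ (Q k predT)); last first.
  by move=> s; rewrite /Q all_predT andbT.
(* Positivity of [k] makes the truncated [k - 1] harmless here. *)
have em : m + k * l = m + (k - 1) * l + 1 * l by nia.
apply/eqP; rewrite eqn_leq; apply/andP; split.
  (* Here [j = 1] and [j' = k]; the division is exact because overlined sizes are multiples of [k].
     The other inequality swaps the roles and multiplies by [k]. *)
  apply: (leq_num_of_trade (h := fun a => a %/ k)) => // a ka.
  by split=> //; rewrite mul1n mulnC divnK.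
apply: (leq_num_of_trade (h := fun a => k * a)) => // a _.
by rewrite dvdn_mulr ?mul1n.
Qed.
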